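(* Let $B(z,\boldsymbol\lambda)$ be a row basis generating a rank-$r$ CMF with shift matrices $M_v(z,\boldsymbol\lambda)$ and differential component $M_{\theta_z}(z,\boldsymbol\lambda)$. Let $\phi\colon\mathbb{P}^1\to\mathbb{P}^1$ be a nonconstant rational map and $\rho(x,\boldsymbol\lambda)$ a nonzero rational function of $x$ (possibly depending on the parameters $\boldsymbol\lambda$). Define $$\widetilde B(x,\boldsymbol\lambda)=\rho(x,\boldsymbol\lambda)\,B\bigl(\phi(x),\boldsymbol\lambda\bigr).$$ Then $\widetilde B$ generates a CMF with $$\widetilde M_v(x,\boldsymbol\lambda)=\frac{\sigma_v(\rho)}{\rho}\,M_v\bigl(\phi(x),\boldsymbol\lambda\bigr),\qquad \widetilde M_{\theta_x}(x,\boldsymbol\lambda)=\frac{x\rho'}{\rho}\,I_r+\frac{x\phi'}{\phi}\,M_{\theta_z}\bigl(\phi(x),\boldsymbol\lambda\bigr).$$ If $\rho$ does not depend on $\boldsymbol\lambda$, then the shift matrices transfer by simple composition: $\widetilde M_v(x)=M_v(\phi(x))$. Moreover, when $r=2$ and $\rho^{1/2}$ denotes a scalar square root of $\rho$, $\operatorname{Sym}^2$ converts the rank-$2$ twist $\rho^{1/2}$ into the rank-$3$ twist $\rho$: $$\operatorname{Sym}^2\bigl(\rho^{1/2}\,B\circ\phi\bigr)=\rho\,\operatorname{Sym}^2(B)\circ\phi.$$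
   Context: A Conservative Matrix Field (CMF) of dimension $d$ and rank $r$ is a map $v\mapsto M_v$ from $\mathbb{Z}^d$ to invertible $r\times r$ matrices of rational functions satisfying $M_{v+w}=M_v\,\sigma_v(M_w)$, where $\sigma_v$ is the shift $\boldsymbol\lambda\mapsto\boldsymbol\lambda+v$ of the parameters $\boldsymbol\lambda$ (acting entrywise and fixing $z$ and $x$). A row basis $B(z,\boldsymbol\lambda)$ of functions generates the CMF with shift matrices $M_v$ and differential component $M_{\theta_z}$ (all with rational-function entries) when $\sigma_v(B)=B\,M_v$ for all $v$ and $\theta_zB=B\,M_{\theta_z}$, with $\theta_z=z\,\frac{d}{dz}$. For $\widetilde B$ the differential component is with respect to $\theta_x=x\,\frac{d}{dx}$: $\theta_x\widetilde B=\widetilde B\,\widetilde M_{\theta_x}$. Primes denote $\frac{d}{dx}$; $I_r$ is the identity matrix. For a row basis $B=(u,v)$ of length $2$, $\operatorname{Sym}^2(B)=(u^2,uv,v^2)$, and $B\circ\phi$ means $B(\phi(x),\boldsymbol\lambda)$. *)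

(* Defs.v *)
From HB Require Import structures.
From mathcomp Require Import all_boot all_order all_algebra.
From mathcomp Require Import fraction complex.
From mathcomp Require Import boolp classical_sets reals topology normedtype.
From mathcomp Require Import derive.
From mathcomp Require mpoly.
(* The notations of mpoly clash with those of MathComp-Analysis. *)
Import -(notations) mpoly.

Set Implicit Arguments.
Unset Strict Implicit.
Unset Printing Implicit Defensive.

Import Order.TTheory GRing.Theory Num.Theory.
Import numFieldNormedType.Exports.
Local Open Scope classical_set_scope.
Local Open Scope ring_scope.

(* C(z) and C(z, lambda_1, ..., lambda_d); the latter is the fraction field of
   C[lambda_1, ..., lambda_d][z].  The variable of the polynomials is called z
   or x according to the context. *)
Notation ratfun1 C := {fraction {poly C}}.
Notation ratfun C d := {fraction {poly (mpoly d C)}}.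

Section FractionExtension.
Variables (A : idomainType) (K : fieldType) (e : A -> K).

(* For a ring morphism e : A -> K, the extension of e to the fractions that
   have at least one representation n / d with e d != 0.  The value does not
   depend on the representation; it is 0 by convention elsewhere. *)
Definition frac_defined (f : {fraction A}) : Prop :=
  exists n m : A, f = tofrac n / tofrac m /\ e m != 0.

Definition frac_ext (f : {fraction A}) : K :=
  xget 0 [set c | exists n m : A,
    [/\ f = tofrac n / tofrac m, e m != 0 & c = e n / e m]].

End FractionExtension.

Section RationalFunctions.
Variables (C : numClosedFieldType) (d : nat).

Definition rat1_defined (x : C) (f : ratfun1 C) : Prop :=
  frac_defined (fun p : {poly C} => p.[x]) f.

Definition rat1_eval (x : C) (f : ratfun1 C) : C :=
  frac_ext (fun p : {poly C} => p.[x]) f.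

Definition poly_eval (x : C) (l : 'rV[C]_d) (p : {poly (mpoly d C)}) : C :=
  (map_poly (meval (fun i => l 0 i)) p).[x].

Definition rat_defined (x : C) (l : 'rV[C]_d) (f : ratfun C d) : Prop :=
  frac_defined (poly_eval x l) f.

Definition rat_eval (x : C) (l : 'rV[C]_d) (f : ratfun C d) : C :=
  frac_ext (poly_eval x l) f.

Definition param_shift (l : 'rV[C]_d) (v : 'rV[int]_d) : 'rV[C]_d :=
  l + map_mx intr v.

(* The shift sigma_v, i.e. the substitution lambda_i := lambda_i + v_i. *)
Definition poly_shift (v : 'rV[int]_d) :
    {poly (mpoly d C)} -> {poly (mpoly d C)} :=
  map_poly (comp_mpoly [tuple mpolyX C (mnm1 i) + (v 0 i)%:~R | i < d]).

Definition rat_shift (v : 'rV[int]_d) (f : ratfun C d) : ratfun C d :=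
  frac_ext (fun p => tofrac (poly_shift v p)) f.

Definition rat_const (f : ratfun1 C) : ratfun C d :=
  frac_ext (fun p : {poly C} => tofrac (map_poly (@mpolyC d C) p)) f.

Definition rat_var : ratfun C d := tofrac 'X.

(* f(z, lambda) |-> f(phi(x), lambda); total when phi is nonconstant. *)
Definition rat_comp (phi : ratfun1 C) (f : ratfun C d) : ratfun C d :=
  frac_ext (fun p : {poly (mpoly d C)} =>
    (map_poly (fun a => tofrac a%:P) p).[rat_const phi]) f.

(* The derivative in the variable z (or x), by the quotient rule. *)
Definition rat_deriv (f : ratfun C d) : ratfun C d :=
  xget 0 [set g | exists n m : {poly (mpoly d C)},
    [/\ m != 0, f = tofrac n / tofrac m
      & g = tofrac (n^`() * m - n * m^`()) / tofrac (m ^+ 2)]].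

End RationalFunctions.

Section ConservativeMatrixFields.
Variables (C : numClosedFieldType) (d r : nat).

Definition is_cmf (M : 'rV[int]_d -> 'M[ratfun C d]_r) : Prop :=
  (forall v, M v \in unitmx) /\
  (forall v w, M (v + w) = M v *m map_mx (rat_shift v) (M w)).

(* The sets of pairs (z, lambda) on which (branches of) functions B(z, lambda)
   are considered.  They are stable under the integer shifts of lambda, and
   their slices are open, so that d/dz makes sense.  These conditions imply
   that such a set is Zariski dense. *)
Definition param_domain (D : set (C * 'rV[C]_d)) : Prop :=
  [/\ D !=set0,
      forall l, open [set z | D (z, l)]
    & forall z l v, D (z, l) -> D (z, param_shift l v)].

(* Identities involving rational functions are understood away from poles,
   hence outside a proper algebraic subset of the domain. *)
Definition generically (D : set (C * 'rV[C]_d)) (P : C -> 'rV[C]_d -> Prop) :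
    Prop :=
  exists2 q : {poly (mpoly d C)}, q != 0 &
    forall z l, D (z, l) -> poly_eval z l q != 0 -> P z l.

(* The entries of B are linearly independent over C(z, lambda). *)
Definition row_basis (D : set (C * 'rV[C]_d)) (B : C -> 'rV[C]_d -> 'rV[C]_r) :
    Prop :=
  forall c : 'cV[ratfun C d]_r,
    generically D (fun z l => B z l *m map_mx (rat_eval z l) c = 0) -> c = 0.

Definition generates (D : set (C * 'rV[C]_d)) (B : C -> 'rV[C]_d -> 'rV[C]_r)
    (M : 'rV[int]_d -> 'M[ratfun C d]_r) (Mtheta : 'M[ratfun C d]_r) : Prop :=
  [/\ param_domain D,
      is_cmf M,
      forall v, generically D (fun z l =>
        B z (param_shift l v) = B z l *m map_mx (rat_eval z l) (M v))
    & generically D (fun z l => forall j : 'I_r,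
        derivable (fun w : C => B w l 0 j) z 1 /\
        z * derive1 (fun w : C => B w l 0 j) z =
          (B z l *m map_mx (rat_eval z l) Mtheta) 0 j)].

(* The domain of B(phi(x), lambda), without the poles of phi. *)
Definition pullback (phi : ratfun1 C) (D : set (C * 'rV[C]_d)) :
    set (C * 'rV[C]_d) :=
  [set p | rat1_defined p.1 phi /\ D (rat1_eval p.1 phi, p.2)].

Definition twist (g : C -> 'rV[C]_d -> C) (phi : ratfun1 C)
    (B : C -> 'rV[C]_d -> 'rV[C]_r) : C -> 'rV[C]_d -> 'rV[C]_r :=
  fun x l => g x l *: B (rat1_eval x phi) l.

End ConservativeMatrixFields.

Definition sym2 (C : numClosedFieldType) (b : 'rV[C]_2) : 'rV[C]_3 :=
  let u := b 0 0 in let v := b 0 1 in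
  \row_(k < 3) nth 0 [:: u ^+ 2; u * v; v ^+ 2] k.

(* Main.v *)
Require Import Defs.
From HB Require Import structures.
From mathcomp Require Import all_boot all_order all_algebra.
From mathcomp Require Import generic_quotient fraction complex.
From mathcomp Require Import boolp classical_sets functions reals topology.
From mathcomp Require Import normedtype.
From mathcomp Require Import derive ring separable.
From mathcomp Require mpoly.
Import -(notations) mpoly.

Set Implicit Arguments.
Unset Strict Implicit.
Unset Printing Implicit Defensive.

Import Order.TTheory GRing.Theory Num.Theory.
Import numFieldNormedType.Exports.
Local Open Scope classical_set_scope.
Local Open Scope ring_scope.
Local Open Scope complex_scope.

(** Substitutions of rational functions are field morphisms, so every identity
    between the matrices is preserved by the composition with [phi]; the scalar
    [sigma_v(rho) / rho] is a coboundary and therefore keeps the cocycle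
    relation. The differential component is the product rule together
    with the chain rule, in logarithmic form. What needs an argument is that
    these formal operations have the expected meaning on functions, and that no
    dependence is created by the composition.

    Everything formal rests on [frac_value], the relation between a fraction and
    its value under a morphism defined on polynomials. It is compatible with the
    field operations and, by [frac_value_comp], with iterated substitution; this
    one lemma gives both the evaluation of [f(phi(x), lambda)] and of
    [f(z, lambda + v)], and the commutation of shifts with compositions. The
    extension is a field morphism as soon as the morphism on polynomials is
    injective, which for the composition is the transcendence of a nonconstant
    [phi] over the parameters ([comp_frac_inj]). The same injectivity shows that
    a generic property of [(z, lambda)] gives a generic property of
    [(x, lambda)] at [z = phi(x)] ([generically_pullback]). The formal
    derivative agrees with the analytic one by [rat_eval_is_derive].

    The independence of the entries over [C(x, lambda)] ([row_basis_twist]) uses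
    that the domain is the full preimage under [phi]. Over a generic [z] there
    are [deg phi] distinct points ([uniq_fibre]), and they avoid any given
    proper algebraic set ([fibre_avoid], by a resultant). A relation upstairs,
    reduced to degree less than [deg phi] in [x], then has too many roots unless
    its coefficients are relations downstairs.

    The symmetric square is quadratic, so it squares the scalar of the twist. *)

(** * Values of fractions *)

Section FracValue.
Variables (A : idomainType) (K : fieldType) (e : {rmorphism A -> K}).

(** The graph of [frac_ext e]. As a relation it carries the existence of a
    representation with nonvanishing denominator, which is exactly what makes
    it stable under the field operations. *)
Definition frac_value (f : {fraction A}) (c : K) : Prop :=
  exists n m : A, [/\ f = tofrac n / tofrac m, e m != 0 & c = e n / e m].

Lemma rmorph_neq0 (a : A) : e a != 0 -> a != 0.
Proof. by apply: contraNneq => ->; rewrite rmorph0. Qed.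

Lemma eq_fracP (n m n' m' : A) : m != 0 -> m' != 0 ->
  (tofrac n / tofrac m == tofrac n' / tofrac m') = (n * m' == n' * m).
Proof.
by move=> m0 m'0; rewrite eqr_div ?tofrac_eq0// -!tofracM tofrac_eq.
Qed.

Lemma frac_value_unique f c c' : frac_value f c -> frac_value f c' -> c = c'.
Proof.
move=> [n [m [-> m0 ->]]] [n' [m' [/eqP E m'0 ->]]].
apply/eqP; rewrite eqr_div// -!rmorphM.
by move: E; rewrite eq_fracP ?rmorph_neq0// => /eqP ->.
Qed.

Lemma frac_value_ext f c : frac_value f c -> frac_ext e f = c.
Proof.
move=> fc; apply: (@frac_value_unique f) => //.
exact: (@xgetI _ 0 [set c | frac_value f c] c fc).
Qed.

Lemma frac_defined_value f : frac_defined e f -> frac_value f (frac_ext e f).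
Proof.
move=> [n [m [fE m0]]].
have fc : frac_value f (e n / e m) by exists n, m.
by rewrite (frac_value_ext fc).
Qed.

Lemma frac_value_defined f c : frac_value f c -> frac_defined e f.
Proof. by move=> [n [m [fE m0 _]]]; exists n, m. Qed.

Lemma frac_value_tofrac a : frac_value (tofrac a) (e a).
Proof.
by exists a, 1; rewrite tofrac1 rmorph1 !divr1; split=> //; exact: oner_neq0.
Qed.

Lemma frac_value_tofrac_eq (f : {fraction A}) (a : A) c :
  f = tofrac a -> c = e a -> frac_value f c.
Proof. by move=> -> ->; exact: frac_value_tofrac. Qed.

Lemma frac_valueD f g a b :
  frac_value f a -> frac_value g b -> frac_value (f + g) (a + b).
Proof.
move=> [n [m [-> m0 ->]]] [n' [m' [-> m'0 ->]]].
exists (n * m' + n' * m), (m * m'); rewrite rmorphM mulf_neq0//; split=> //.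
  by rewrite addf_div ?tofrac_eq0 ?rmorph_neq0// tofracD !tofracM.
by rewrite addf_div// rmorphD !rmorphM.
Qed.

Lemma frac_valueM f g a b :
  frac_value f a -> frac_value g b -> frac_value (f * g) (a * b).
Proof.
move=> [n [m [-> m0 ->]]] [n' [m' [-> m'0 ->]]].
exists (n * n'), (m * m'); rewrite rmorphM mulf_neq0//; split=> //.
  by rewrite mulf_div !tofracM.
by rewrite mulf_div !rmorphM.
Qed.

Lemma frac_valueV f a : frac_value f a -> a != 0 -> frac_value f^-1 a^-1.
Proof.
move=> [n [m [-> m0 ->]]]; rewrite mulf_eq0 invr_eq0 negb_or m0 andbT => n0.
by exists m, n; rewrite !invf_div.
Qed.

Lemma frac_value_div f g a b : frac_value f a -> frac_value g b -> b != 0 ->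
  frac_value (f / g) (a / b).
Proof. by move=> fa gb b0; apply: frac_valueM => //; exact: frac_valueV. Qed.

Lemma frac_value0 : frac_value 0 0.
Proof. by apply: (@frac_value_tofrac_eq _ 0); rewrite ?tofrac0 ?rmorph0. Qed.

End FracValue.

Lemma frac_repr (A : idomainType) (f : {fraction A}) :
  exists n m : A, m != 0 /\ f = tofrac n / tofrac m.
Proof.
elim/quotW: f => x; exists (frac x).1, (frac x).2.
split; first exact: denom_ratioP.
(* Division in the quotient is induced by division of pairs, so both sides are
   classes of pairs. *)
rewrite -[RHS]/(FracField.mul _ (FracField.inv _)) !piE.
by rewrite /FracField.mulf /FracField.invf !numden_Ratio ?oner_eq0
  ?denom_ratioP// mul1r mulr1 Ratio_numden.
Qed.

Section FracExtTotal.
Variables (A : idomainType) (K : fieldType) (e : {rmorphism A -> K}).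
Hypothesis e_inj : injective e.

(** Injectivity keeps every denominator away from zero, so the extension is
    defined everywhere. *)
Lemma frac_value_total f : frac_value e f (frac_ext e f).
Proof.
apply: frac_defined_value; have [n [m [m0 ->]]] := frac_repr f.
by exists n, m; rewrite (raddf_eq0 _ e_inj).
Qed.

Lemma frac_ext_zmod_morphism : zmod_morphism (frac_ext e).
Proof.
move=> f g; apply: frac_value_ext.
apply: frac_valueD; first exact: frac_value_total.
rewrite -[- g]mulN1r -[- frac_ext e g]mulN1r.
apply: frac_valueM; last exact: frac_value_total.
by apply: (@frac_value_tofrac_eq _ _ _ _ (-1)); rewrite rmorphN1.
Qed.

Lemma frac_ext_monoid_morphism : monoid_morphism (frac_ext e).
Proof.
split=> [|f g]; apply: frac_value_ext.
  by apply: (@frac_value_tofrac_eq _ _ _ _ 1); rewrite ?tofrac1 ?rmorph1.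
by apply: frac_valueM; exact: frac_value_total.
Qed.

End FracExtTotal.

(** Both the evaluation of a composite and the commutation of two
    substitutions follow from this: to extend a morphism [e''] that factors
    through [e] and [e'] on polynomials, extend [e] and [e'] one after the
    other. *)
Lemma frac_value_comp (A A' : idomainType) (K : fieldType)
    (e : {rmorphism A -> {fraction A'}}) (e' : {rmorphism A' -> K})
    (e'' : {rmorphism A -> K}) f c :
  (forall a, frac_value e' (e a) (e'' a)) ->
  frac_value e'' f c -> frac_value e' (frac_ext e f) c.
Proof.
move=> He [n [m [fE m0 ->]]].
have em0 : e m != 0.
  apply: contraNneq m0 => em0; have := He m; rewrite em0 => /frac_value_unique.
  by move=> /(_ _ (frac_value0 _)) ->.
suff -> : frac_ext e f = e n / e m by exact: frac_value_div.
by apply: frac_value_ext; exists n, m.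
Qed.

(** * The substitutions *)

Section Substitutions.
Variables (C : numClosedFieldType) (d : nat).
Local Notation A := (mpoly d C).
Implicit Types (v w : 'rV[int]_d) (l : 'rV[C]_d) (x : C).

(** Identities between substitutions, and between a substitution and an
    evaluation, are checked on constants, on the parameters and on the main
    variable. *)
Lemma bipoly_rmorph_eq (S : comNzRingType) (f g : {rmorphism {poly A} -> S}) :
  (forall c, f (mpolyC d c)%:P = g (mpolyC d c)%:P) ->
  (forall i, f (mpolyX C (mnm1 i))%:P = g (mpolyX C (mnm1 i))%:P) ->
  f 'X = g 'X -> f =1 g.
Proof.
move=> fgC fgX fgZ p; elim/poly_ind: p => [|p a IH]; first by rewrite !rmorph0.
rewrite !rmorphD !rmorphM /= IH fgZ; congr (_ + _).
rewrite [a]mpolyE !rmorph_sum; apply: eq_bigr => m _.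
rewrite -mul_mpolyC !rmorphM /= fgC; congr (_ * _).
rewrite mpolyXE_id !rmorph_prod; apply: eq_bigr => i _.
by rewrite !rmorphXn /= fgX.
Qed.

HB.instance Definition _ x l := GRing.RMorphism.copy (@poly_eval C d x l)
  (horner_eval x \o map_poly (meval (fun i => l 0 i))).

Definition eval_at x l : {rmorphism {poly A} -> C} := @poly_eval C d x l.

HB.instance Definition _ v := GRing.RMorphism.copy (@poly_shift C d v)
  (map_poly (comp_mpoly [tuple mpolyX C (mnm1 i) + (v 0 i)%:~R | i < d])).

Lemma poly_evalC x l (a : A) : poly_eval x l a%:P = meval (fun i => l 0 i) a.
Proof. by rewrite /poly_eval map_polyC hornerC. Qed.

Lemma poly_evalX x l : poly_eval x l 'X = x.
Proof. by rewrite /poly_eval map_polyX hornerX. Qed.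

Lemma poly_evalM x l (p q : {poly A}) :
  poly_eval x l (p * q) = poly_eval x l p * poly_eval x l q.
Proof. exact: rmorphM. Qed.

Lemma poly_eval_map_mpolyC x l (p : {poly C}) :
  poly_eval x l (map_poly (@mpolyC d C) p) = p.[x].
Proof.
rewrite /poly_eval -map_poly_comp (eq_map_poly (g := idfun)) ?map_poly_id//.
by move=> c; rewrite /= mevalC.
Qed.

Lemma poly_shiftC v (a : A) : poly_shift v a%:P =
  (comp_mpoly [tuple mpolyX C (mnm1 i) + (v 0 i)%:~R | i < d] a)%:P.
Proof. by rewrite /poly_shift map_polyC. Qed.

Lemma poly_shift_const v c :
  poly_shift v (mpolyC d c)%:P = (mpolyC d c)%:P :> {poly A}.
Proof. by rewrite poly_shiftC comp_mpolyC. Qed.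

Lemma poly_shift_param v i : poly_shift v (mpolyX C (mnm1 i))%:P =
  (mpolyX C (mnm1 i))%:P + (v 0 i)%:~R :> {poly A}.
Proof.
rewrite poly_shiftC comp_mpolyXU -tnth_nth tnth_map tnth_ord_tuple.
by rewrite rmorphD rmorph_int.
Qed.

Lemma poly_shiftX v : poly_shift v 'X = 'X :> {poly A}.
Proof. by rewrite /poly_shift map_polyX. Qed.

Lemma poly_shiftD v w (p : {poly A}) :
  poly_shift v (poly_shift w p) = poly_shift (v + w) p.
Proof.
move: p; apply: (@bipoly_rmorph_eq _ (poly_shift v \o poly_shift w)
  (poly_shift (v + w))) => /=.
- by move=> c; rewrite !poly_shift_const.
- move=> i; rewrite !poly_shift_param rmorphD /= poly_shift_param rmorph_int.
  by rewrite mxE intrD addrA.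
- by rewrite !poly_shiftX.
Qed.

Lemma poly_shift0 (p : {poly A}) : poly_shift 0 p = p.
Proof.
move: p; apply: (@bipoly_rmorph_eq _ (poly_shift 0) idfun) => /=.
- by move=> c; rewrite !poly_shift_const.
- by move=> i; rewrite poly_shift_param mxE addr0.
- by rewrite !poly_shiftX.
Qed.

Lemma poly_shift_inj v : injective (@poly_shift C d v).
Proof.
apply: (can_inj (g := poly_shift (- v))) => p.
by rewrite poly_shiftD addNr poly_shift0.
Qed.

Lemma poly_eval_shift x l v (p : {poly A}) :
  poly_eval x l (poly_shift v p) = poly_eval x (param_shift l v) p.
Proof.
move: p; apply: (@bipoly_rmorph_eq _ (poly_eval x l \o poly_shift v)
  (poly_eval x (param_shift l v))) => /=.
- by move=> c; rewrite poly_shift_const !poly_evalC !mevalC.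
- move=> i; rewrite poly_shift_param rmorphD /= !poly_evalC !mevalXU rmorph_int.
  by rewrite !mxE.
- by rewrite poly_shiftX !poly_evalX.
Qed.

(** The three morphisms on polynomials whose extensions to fractions are
    [rat_const], [rat_shift] and [rat_comp]. *)
Definition poly_const : {rmorphism {poly C} -> ratfun C d} :=
  @tofrac {poly A} \o map_poly (@mpolyC d C).

Definition shift_frac v : {rmorphism {poly A} -> ratfun C d} :=
  @tofrac {poly A} \o poly_shift v.

Definition comp_frac (phi : ratfun1 C) : {rmorphism {poly A} -> ratfun C d} :=
  horner_eval (rat_const d phi) \o map_poly (@tofrac {poly A} \o polyC).

Lemma poly_const_inj : injective poly_const.
Proof.
move=> p q /eqP; rewrite /= tofrac_eq => /eqP.
apply: map_inj_poly => [a b|]; last exact: mpolyC0.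
  exact: (can_inj (@mpolyCK _ _)).
Qed.

Lemma shift_frac_inj v : injective (shift_frac v).
Proof. by move=> p q /eqP; rewrite /= tofrac_eq => /eqP /poly_shift_inj. Qed.

Lemma comp_fracC phi (a : A) : comp_frac phi a%:P = tofrac a%:P.
Proof. by rewrite /comp_frac /= map_polyC /horner_eval hornerC. Qed.

Lemma comp_fracX phi : comp_frac phi 'X = rat_const d phi.
Proof. by rewrite /comp_frac /= map_polyX /horner_eval hornerX. Qed.

HB.instance Definition _ := GRing.isZmodMorphism.Build _ _ (@rat_const C d)
  (frac_ext_zmod_morphism poly_const_inj).
HB.instance Definition _ := GRing.isMonoidMorphism.Build _ _ (@rat_const C d)
  (frac_ext_monoid_morphism poly_const_inj).

HB.instance Definition _ v := GRing.isZmodMorphism.Build _ _ (@rat_shift C d v)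
  (frac_ext_zmod_morphism (@shift_frac_inj v)).
HB.instance Definition _ v := GRing.isMonoidMorphism.Build _ _
  (@rat_shift C d v) (frac_ext_monoid_morphism (@shift_frac_inj v)).

Lemma rat_shift_const v (f : ratfun1 C) :
  rat_shift v (rat_const d f) = rat_const d f.
Proof.
apply: (@frac_value_ext _ _ (shift_frac v)).
apply: (@frac_value_comp _ _ _ poly_const (shift_frac v) poly_const);
  last exact: (frac_value_total poly_const_inj).
move=> p; apply: frac_value_tofrac_eq; first by [].
rewrite /=; congr tofrac.
rewrite /poly_shift -map_poly_comp.
by apply: eq_map_poly => c; rewrite /= comp_mpolyC.
Qed.

Lemma rat_shiftD v w (f : ratfun C d) :
  rat_shift v (rat_shift w f) = rat_shift (v + w) f.
Proof.
apply: (@frac_value_ext _ _ (shift_frac v)).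
apply: (@frac_value_comp _ _ _ (shift_frac w) (shift_frac v)
  (shift_frac (v + w))); last exact: (frac_value_total (@shift_frac_inj _)).
move=> p; apply: frac_value_tofrac_eq; first by [].
by rewrite /= poly_shiftD.
Qed.

End Substitutions.

(** * The fibres of a rational map *)

Lemma poly_nonroot (R : idomainType) (p : {poly R}) (f : nat -> R) :
  injective f -> p != 0 -> exists k, p.[f k] != 0.
Proof.
move=> f_inj p0; apply: contrapT => nroot.
have := @max_poly_roots _ p (map f (iota 0 (size p))) p0.
rewrite size_map size_iota ltnn map_inj_uniq// iota_uniq => H.
suff /H : all (root p) (map f (iota 0 (size p))) by move/(_ isT).
apply/allP => _ /mapP[k _ ->]; apply/negPn/negP => pk; apply: nroot.
by exists k.
Qed.

Lemma frac_coprime_repr (F : fieldType) (f : {fraction {poly F}}) :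
  exists N M : {poly F}, [/\ coprimep N M, M != 0 & f = tofrac N / tofrac M].
Proof.
have [n [m [m0 ->]]] := frac_repr f.
have g0 : gcdp n m != 0 by rewrite gcdp_eq0 negb_and m0 orbT.
have nE := divpK (dvdp_gcdl n m); have mE := divpK (dvdp_gcdr n m).
exists (n %/ gcdp n m), (m %/ gcdp n m); split.
- by apply: coprimep_div_gcd; rewrite m0 orbT.
- by move: m0; rewrite -{1}mE mulf_eq0 negb_or => /andP[].
- apply/eqP; rewrite eq_fracP//; last first.
    by move: m0; rewrite -{1}mE mulf_eq0 negb_or => /andP[].
  rewrite -[X in X * _ == _]nE -[X in _ == _ * X]mE -!mulrA.
  by rewrite [gcdp n m * _]mulrC.
Qed.

Section Fibre.
Variables (C : numClosedFieldType) (N M : {poly C}).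
Hypothesis NM_coprime : coprimep N M.
Local Notation phi := (tofrac N / tofrac M).
Hypothesis phi_nonconstant : forall c, phi <> tofrac c%:P.

Local Notation deg := (maxn (size N) (size M)).-1.

(** Since [N] and [M] are coprime, the roots of this polynomial are the
    preimages of [z] under [N / M]. *)
Definition fibre (z : C) := N - z *: M.

(** The coefficient of [fibre z] in the generic degree, as a polynomial in
    [z]: where it vanishes, some preimages of [z] have escaped to infinity. *)
Definition fibre_lead : {poly C} := (N`_deg)%:P - M`_deg *: 'X.

Let M_neq0 : M != 0.
Proof.
apply/eqP => M0; apply: (phi_nonconstant (c := 0)).
by rewrite M0 !tofrac0 invr0 mulr0.
Qed.

Lemma fibre_deg_gt0 : (0 < deg)%N.
Proof.
rewrite lt0n -subn1 subn_eq0 geq_max; apply/negP.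
case/andP=> /size1_polyC NE /size1_polyC ME.
have b0 : M`_0 != 0 by apply: contra M_neq0 => /eqP b0; rewrite ME b0 polyC0.
apply: (phi_nonconstant (c := N`_0 / M`_0)).
rewrite {1}NE {1}ME -[tofrac (_ / _)%:P]divr1 -tofrac1; apply/eqP.
by rewrite eq_fracP ?polyC_eq0 ?oner_eq0// mulr1 -polyCM divfK.
Qed.

Lemma fibre_lead_neq0 : fibre_lead != 0.
Proof.
have dS : maxn (size N) (size M) = deg.+1.
  by rewrite prednK// (leq_trans fibre_deg_gt0)// leq_pred.
have lead (p : {poly C}) : size p = deg.+1 -> p`_deg <> 0.
  move=> sp; have := lead_coef_eq0 p; rewrite /lead_coef sp /= => E.
  by move/eqP; rewrite E -size_poly_eq0 sp.
apply/eqP => /polyP s0.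
have := s0 0; rewrite !coefE mulr0 subr0 /= => N0.
have := s0 1; rewrite !coefE /= mulr1 sub0r => /eqP.
rewrite oppr_eq0 => /eqP M0.
have [le|/ltnW le] := leqP (size N) (size M).
  by have /lead : size M = deg.+1 by rewrite -dS (maxn_idPr le).
by have /lead : size N = deg.+1 by rewrite -dS (maxn_idPl le).
Qed.

Lemma size_fibre z : fibre_lead.[z] != 0 -> size (fibre z) = deg.+1.
Proof.
rewrite !hornerE mulrC => sz; apply/eqP; rewrite eqn_leq; apply/andP; split.
  rewrite prednK; last by rewrite (leq_trans fibre_deg_gt0)// leq_pred.
  apply: leq_trans (size_polyD _ _) _; rewrite size_polyN geq_max leq_maxl /=.
  by apply: leq_trans (size_scale_leq _ _) _; exact: leq_maxr.
rewrite ltnNge; apply/negP => /leq_sizeP/(_ _ (leqnn _))/eqP.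
by rewrite coefB coefZ (negPf sz).
Qed.

Lemma fibre_root z x : root (fibre z) x -> M.[x] != 0 /\ N.[x] = z * M.[x].
Proof.
rewrite /fibre /root hornerD hornerN hornerZ subr_eq0 => /eqP NE; split=> //.
apply/negP => /eqP Mx; have /coprimep_root := NM_coprime.
by move=> /(_ x); rewrite /root NE Mx mulr0 eqxx => /(_ isT).
Qed.

Lemma fibre_nonempty z : fibre_lead.[z] != 0 -> exists x, root (fibre z) x.
Proof.
move=> sz; apply/closed_rootP; rewrite size_fibre// eqSS -lt0n.
exact: fibre_deg_gt0.
Qed.

Lemma rat1_definedP x : rat1_defined x phi <-> M.[x] != 0.
Proof.
split=> [[n [m [/eqP E mx]]]|Mx]; last by exists N, M.
have m0 : m != 0 by apply: contraNneq mx => ->; rewrite horner0.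
move: E; rewrite eq_fracP// => /eqP/(congr1 (horner^~ x)).
rewrite !hornerM => E.
apply/negP => /eqP Mx; move: E; rewrite Mx mulr0 => /eqP.
rewrite mulf_eq0 (negPf mx) orbF => Nx.
by have := coprimep_root NM_coprime Nx; rewrite Mx eqxx.
Qed.

Lemma rat1_evalE x : M.[x] != 0 -> rat1_eval x phi = N.[x] / M.[x].
Proof.
by move=> Mx; apply: (@frac_value_ext _ _ (horner_eval x)); exists N, M.
Qed.

Lemma fibre_rat1 z x : root (fibre z) x ->
  rat1_defined x phi /\ rat1_eval x phi = z.
Proof.
move=> /fibre_root[Mx Nx]; split; first exact/rat1_definedP.
by rewrite rat1_evalE// Nx mulfK.
Qed.

End Fibre.

(** * Composition with a rational map *)

Section Composition.
Variables (C : numClosedFieldType) (d : nat).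
Local Notation A := (mpoly d C).
Implicit Types (x : C) (l : 'rV[C]_d) (v w : 'rV[int]_d) (phi : ratfun1 C)
  (f : ratfun C d) (p : {poly A}).

Lemma comp_frac_value (K : fieldType) (e : {rmorphism {poly A} -> K}) phi u
    (p : {poly A}) :
  frac_value e (rat_const d phi) u ->
  frac_value e (comp_frac d phi p) (map_poly (e \o polyC) p).[u].
Proof.
move=> phiu; elim/poly_ind: p => [|p a IH].
  by rewrite !rmorph0 horner0; exact: frac_value0.
have -> : (map_poly (e \o polyC) (p * 'X + a%:P)).[u] =
    (map_poly (e \o polyC) p).[u] * u + e a%:P.
  by rewrite rmorphD rmorphM /= map_polyX map_polyC hornerD hornerMX hornerC.
rewrite rmorphD rmorphM; apply: frac_valueD.
  by apply: frac_valueM => //; rewrite comp_fracX.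
by rewrite comp_fracC; exact: frac_value_tofrac.
Qed.

Lemma rat_const_value x (l : 'rV[C]_d) phi : rat1_defined x phi ->
  frac_value (eval_at x l) (rat_const d phi) (rat1_eval x phi).
Proof.
move=> phix.
apply: (@frac_value_comp _ _ _ (poly_const C d) (eval_at x l) (horner_eval x));
  last exact: frac_defined_value.
move=> p; rewrite /= /horner_eval -(poly_eval_map_mpolyC x l).
exact: frac_value_tofrac.
Qed.

Lemma comp_frac_eval x (l : 'rV[C]_d) phi p : rat1_defined x phi ->
  frac_value (eval_at x l) (comp_frac d phi p)
    (poly_eval (rat1_eval x phi) l p).
Proof.
move=> /(rat_const_value l)/(comp_frac_value p).
rewrite (_ : map_poly _ p = map_poly (meval (fun i => l 0 i)) p)//.
by apply: eq_map_poly => a; rewrite /= poly_evalC.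
Qed.

Lemma rat_comp_value x (l : 'rV[C]_d) phi f c : rat1_defined x phi ->
  frac_value (eval_at (rat1_eval x phi) l) f c ->
  frac_value (eval_at x l) (rat_comp phi f) c.
Proof.
move=> phix; apply: (@frac_value_comp _ _ _ (comp_frac d phi)) => p.
exact: comp_frac_eval.
Qed.

Lemma rat_shift_value x (l : 'rV[C]_d) v f c :
  frac_value (eval_at x (param_shift l v)) f c ->
  frac_value (eval_at x l) (rat_shift v f) c.
Proof.
apply: (@frac_value_comp _ _ _ (shift_frac C v)) => p.
rewrite /= -poly_eval_shift; exact: frac_value_tofrac.
Qed.

Lemma rat_shift_comp_frac v phi p :
  rat_shift v (comp_frac d phi p) = comp_frac d phi (poly_shift v p).
Proof.
have shift_tofrac a :
    rat_shift v (tofrac a) = tofrac (poly_shift v a) :> ratfun C d.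
  apply: (@frac_value_ext _ _ (shift_frac C v)); exact: frac_value_tofrac.
move: p; apply: (@bipoly_rmorph_eq _ _ _ (rat_shift v \o comp_frac d phi)
  (comp_frac d phi \o poly_shift v)).
- move=> c; change (rat_shift v (comp_frac d phi (mpolyC d c)%:P) =
    comp_frac d phi (poly_shift v (mpolyC d c)%:P)).
  by rewrite poly_shift_const !comp_fracC shift_tofrac poly_shift_const.
- move=> i; change (rat_shift v (comp_frac d phi (mpolyX C (mnm1 i))%:P) =
    comp_frac d phi (poly_shift v (mpolyX C (mnm1 i))%:P)).
  rewrite poly_shift_param rmorphD rmorph_int !comp_fracC shift_tofrac.
  by rewrite poly_shift_param tofracD rmorph_int.
- change (rat_shift v (comp_frac d phi 'X) = comp_frac d phi (poly_shift v 'X)).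
  by rewrite poly_shiftX comp_fracX rat_shift_const.
Qed.

Section Nonconstant.
Variable phi : ratfun1 C.
Hypothesis phi_nonconstant : forall c, phi <> tofrac c%:P.

(** This says that [phi] is transcendental over the polynomials in the
    parameters. If [a] were to vanish at [phi], then specializing the variable
    at constants [x] would make every value [phi x] a root of [a]; but a
    nonconstant rational map takes all constants outside a finite set as
    values. *)
Lemma comp_frac_inj : injective (comp_frac d phi).
Proof.
apply: raddf_inj => a a0; apply/eqP/negPn/negP => an0.
have [N [M [cop _ phiE]]] := frac_coprime_repr phi.
have nc c : tofrac N / tofrac M <> tofrac c%:P by rewrite -phiE.
pose s := map_poly (@mpolyC d C) (fibre_lead N M).
have s0 : s != 0.
  rewrite map_poly_eq0_id0 ?fibre_lead_neq0//.
  by rewrite mpolyC_eq0 lead_coef_eq0 fibre_lead_neq0.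
have inj : injective (fun k => mpolyC d (k%:R : C)).
  by move=> i j /(can_inj (@mpolyCK _ _)) /eqP; rewrite eqr_nat => /eqP.
have [k] := poly_nonroot inj (mulf_neq0 an0 s0).
rewrite hornerM mulf_eq0 negb_or horner_map /= mpolyC_eq0 => /andP[az sz].
have [x /(fibre_root cop)[Mx Nx]] := fibre_nonempty nc sz.
(* Specialize the variable, but not the parameters, at a preimage of [k]. *)
pose e : {rmorphism {poly A} -> {fraction A}} :=
  @tofrac A \o horner_eval (mpolyC d x).
have phix : frac_value e (rat_const d phi) (tofrac (mpolyC d k%:R)).
  pose e'' : {rmorphism {poly C} -> {fraction A}} :=
    @tofrac A \o @mpolyC d C \o horner_eval x.
  apply: (@frac_value_comp _ _ _ (poly_const C d) e e'').
    move=> p; rewrite /= /horner_eval -horner_map.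
    exact: (frac_value_tofrac e).
  exists N, M; rewrite phiE /= /horner_eval tofrac_eq0 mpolyC_eq0; split=> //.
  by rewrite Nx mpolyCM tofracM mulfK// tofrac_eq0 mpolyC_eq0.
have := comp_frac_value a phix.
rewrite a0 => /frac_value_unique/(_ (frac_value0 _)) /eqP.
rewrite (_ : map_poly _ a = map_poly (@tofrac A) a).
  by rewrite horner_map tofrac_eq0 (negPf az).
by apply: eq_map_poly => b; rewrite /= /horner_eval hornerC.
Qed.

(** [rat_comp phi] is multiplicative and additive only for nonconstant [phi];
    the hypothesis rules out a canonical instance, so a morphism that agrees
    with it is exhibited instead. *)
Lemma rat_comp_rmorphism :
  exists g : {rmorphism ratfun C d -> ratfun C d}, g =1 rat_comp phi.
Proof.
pose hz := GRing.isZmodMorphism.Build _ _ (@rat_comp C d phi)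
  (frac_ext_zmod_morphism comp_frac_inj).
pose hm := GRing.isMonoidMorphism.Build _ _ (@rat_comp C d phi)
  (frac_ext_monoid_morphism comp_frac_inj).
by exists (HB.pack (@rat_comp C d phi) hz hm : {rmorphism _ -> _}).
Qed.

(** The shift moves only the parameters and the composition only the variable,
    so both orders extend the same morphism on polynomials. *)
Lemma rat_comp_shift v f :
  rat_comp phi (rat_shift v f) = rat_shift v (rat_comp phi f).
Proof.
pose e'' : {rmorphism {poly A} -> ratfun C d} :=
  comp_frac d phi \o poly_shift v.
have e''_inj : injective e''.
  by apply: inj_comp comp_frac_inj (@poly_shift_inj _ _ v).
transitivity (frac_ext e'' f).
  apply: (@frac_value_ext _ _ (comp_frac d phi)).
  apply: (@frac_value_comp _ _ _ (shift_frac C v) (comp_frac d phi) e'');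
    last exact: frac_value_total.
  by move=> p; apply: frac_value_tofrac_eq.
apply/esym; apply: (@frac_value_ext _ _ (shift_frac C v)).
apply: (@frac_value_comp _ _ _ (comp_frac d phi) (shift_frac C v) e'');
  last exact: frac_value_total.
move=> p; rewrite -[e'' p]/(comp_frac d phi (poly_shift v p)).
rewrite -rat_shift_comp_frac; exact: (frac_value_total (@shift_frac_inj C d v)).
Qed.

End Nonconstant.
End Composition.

(** * Derivatives *)

Section ComplexDerivatives.
Variable C : numFieldType.
Implicit Types (f g : C -> C) (x : C).

Lemma is_derive_horner (p : {poly C}) x :
  is_derive x 1 (fun w => p.[w]) p^`().[x].
Proof.
elim/poly_ind: p => [|p a IH].
  rewrite deriv0 horner0 (_ : (fun w => _) = cst 0); first exact: is_derive_cst.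
  by apply/funext => w; rewrite horner0.
rewrite (_ : (fun w => _) = (fun w => p.[w]) * id + cst a); last first.
  by apply/funext => w; rewrite hornerMXaddC.
apply: is_derive_eq.
rewrite derivD derivM derivX derivC addr0 !hornerE /=.
by rewrite -[p.[x] *: 1]/(p.[x] * 1) -[x *: _]/(x * _) mulr1 addrC mulrC.
Qed.

Lemma near_horner_neq0 (p : {poly C}) x :
  p.[x] != 0 -> \forall w \near x, p.[w] != 0.
Proof.
move=> px; have [dp _] := is_derive_horner p x.
have cp : {for x, continuous (fun w => p.[w])}.
  exact/differentiable_continuous/derivable1_diffP.
exact: cvgr_neq0 cp px.
Qed.

Lemma is_derive_quotient (p q : {poly C}) x : q.[x] != 0 ->
  is_derive x 1 (fun w => p.[w] / q.[w])
    ((p^`() * q - p * q^`()).[x] / q.[x] ^+ 2).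
Proof.
move=> qx; have [dp dpE] := is_derive_horner p x.
have [dq dqE] := is_derive_horner q x; have dV := derivableV qx dq.
apply: DeriveDef; first exact: derivableM.
rewrite deriveM// deriveV// dpE dqE hornerD hornerN !hornerM.
rewrite -[LHS]/(p.[x] * (- q.[x] ^- 2 * q^`().[x]) + q.[x]^-1 * p^`().[x]).
by field.
Qed.

Lemma is_derive1_chain f g x df dg :
  is_derive x 1 f df -> is_derive (f x) 1 g dg ->
  is_derive x 1 (g \o f) (dg * df).
Proof.
move=> [fx <-] [gx <-].
have /derivable1_diffP Df := fx; have /derivable1_diffP Dg := gx.
apply: DeriveDef; first exact/derivable1_diffP/differentiable_comp.
rewrite !deriveE//; last exact: differentiable_comp.
rewrite diff_comp //= -[X in 'd g _ X = _]mulr1.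
by rewrite [LHS]linearZ mulrC.
Qed.

Lemma derive1_twist (rho phi b : C -> C) x drho dphi :
  is_derive x 1 rho drho -> is_derive x 1 phi dphi -> derivable b (phi x) 1 ->
  derivable (fun w => rho w * b (phi w)) x 1 /\
  derive1 (fun w => rho w * b (phi w)) x =
    rho x * (derive1 b (phi x) * dphi) + b (phi x) * drho.
Proof.
move=> [drho' <-] Dphi /derivableP Db.
have [dbphi dbphiE] := is_derive1_chain Dphi Db.
split; first exact: derivableM.
by rewrite derive1E deriveM// dbphiE derive1E.
Qed.

End ComplexDerivatives.

(** The quotient rule gives equal fractions on two representations of the same
    fraction; [dn], [dm], [dn'], [dm'] stand for the derivatives. *)
Lemma quotient_rule_congr (R : comNzRingType) (n m n' m' dn dm dn' dm' : R) :
  n * m' = n' * m -> dn * m' + n * dm' = dn' * m + n' * dm ->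
  (dn * m - n * dm) * m' ^+ 2 = (dn' * m' - n' * dm') * m ^+ 2.
Proof.
move=> /eqP; rewrite -subr_eq0 => /eqP E /eqP; rewrite -subr_eq0 => /eqP dE.
apply/eqP; rewrite -subr_eq0; apply/eqP.
transitivity (m * m' * (dn * m' + n * dm' - (dn' * m + n' * dm))
  - (dm * m' + dm' * m) * (n * m' - n' * m)); first by ring.
by rewrite E dE !mulr0 subr0.
Qed.

Section RatDerivatives.
Variables (C : numClosedFieldType) (d : nat).
Local Notation A := (mpoly d C).
Implicit Types (x z : C) (l : 'rV[C]_d) (phi : ratfun1 C) (f : ratfun C d).

Lemma rat_deriv_frac (n m : {poly A}) : m != 0 ->
  rat_deriv (tofrac n / tofrac m) =
  tofrac (n^`() * m - n * m^`()) / tofrac (m ^+ 2).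
Proof.
move=> m0; rewrite /rat_deriv; case: xgetP => [g _|H]; last first.
  by case: (H _ (ex_intro _ n (ex_intro _ m (And3 m0 erefl erefl)))).
move=> [n' [m' [m'0 /eqP E ->]]]; apply/eqP; rewrite eq_fracP ?expf_neq0//.
move: E; rewrite eq_fracP// => /eqP E; apply/eqP/esym.
by apply: quotient_rule_congr => //; rewrite -!derivM E.
Qed.

Lemma poly_eval_deriv x l (p : {poly A}) : poly_eval x l p^`() =
  (map_poly (meval (fun i => l 0 i)) p)^`().[x].
Proof. by rewrite /poly_eval deriv_map. Qed.

(** The formal derivative is the analytic one: near [z] the function is a
    quotient of two polynomials in [w]. *)
Lemma rat_eval_is_derive z l f : rat_defined z l f ->
  rat_defined z l (rat_deriv f) /\
  is_derive z 1 (fun w => rat_eval w l f) (rat_eval z l (rat_deriv f)).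
Proof.
move=> [n [m [-> mz]]].
have m0 : m != 0 := @rmorph_neq0 _ _ (eval_at z l) m mz.
have vd : frac_value (eval_at z l) (rat_deriv (tofrac n / tofrac m))
  (eval_at z l (n^`() * m - n * m^`()) / eval_at z l (m ^+ 2)).
  rewrite rat_deriv_frac//.
  eexists; eexists; split; [reflexivity| |reflexivity].
  by rewrite rmorphXn expf_neq0.
split; first exact: frac_value_defined vd.
rewrite [rat_eval z l _](frac_value_ext vd).
set ml := map_poly (meval (fun i => l 0 i)) m.
set nl := map_poly (meval (fun i => l 0 i)) n.
apply: (@near_eq_is_derive _ _ _ (fun w => nl.[w] / ml.[w])).
  have := near_horner_neq0 (p := ml) mz; apply: filterS => w mw; apply/esym.
  by apply: (@frac_value_ext _ _ (eval_at w l)); exists n, m.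
rewrite rmorphXn rmorphB !rmorphM /= !poly_eval_deriv -/ml -/nl.
rewrite -[poly_eval z l m]/(ml.[z]) -[poly_eval z l n]/(nl.[z]).
by rewrite -!hornerM -hornerN -hornerD; exact: is_derive_quotient.
Qed.

Lemma near_rat1_defined x phi : rat1_defined x phi ->
  \forall w \near x, rat1_defined w phi.
Proof.
move=> [n [m [-> mx]]]; have := near_horner_neq0 mx.
by apply: filterS => w mw; exists n, m.
Qed.

Lemma rat1_eval_is_derive x l phi : rat1_defined x phi ->
  is_derive x 1 (fun w => rat1_eval w phi)
    (rat_eval x l (rat_deriv (rat_const d phi))).
Proof.
move=> phix; have v w : rat1_defined w phi -> _ := @rat_const_value C d w l phi.
have [_] := rat_eval_is_derive (frac_value_defined (v _ phix)).
apply: near_eq_is_derive; have := near_rat1_defined phix.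
by apply: filterS => w /v/frac_value_ext.
Qed.

End RatDerivatives.

Lemma rat1_eval_continuous (C : numClosedFieldType) (x : C) (phi : ratfun1 C) :
  rat1_defined x phi -> {for x, continuous (fun w => rat1_eval w phi)}.
Proof.
move=> /(rat1_eval_is_derive (0 : 'rV[C]_0)) [dphi _].
exact/differentiable_continuous/derivable1_diffP.
Qed.

(** * Generic identities *)

Section Generic.
Variables (C : numClosedFieldType) (d : nat).
Local Notation A := (mpoly d C).
Implicit Types (x z : C) (l : 'rV[C]_d) (phi : ratfun1 C) (f : ratfun C d).
Implicit Types (D : set (C * 'rV[C]_d)) (P Q : C -> 'rV[C]_d -> Prop).

Lemma rat_var_value x l : frac_value (eval_at x l) (rat_var C d) x.
Proof.
have := frac_value_tofrac (eval_at x l) 'X.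
by rewrite [eval_at x l 'X]poly_evalX.
Qed.

Lemma generically_imp D P Q :
  (forall z l, D (z, l) -> P z l -> Q z l) ->
  generically D P -> generically D Q.
Proof.
move=> PQ [q q0 qP]; exists q => // z l Dzl.
by move=> /(qP _ _ Dzl)/(PQ _ _ Dzl).
Qed.

Lemma generically_and D P Q : generically D P -> generically D Q ->
  generically D (fun z l => P z l /\ Q z l).
Proof.
move=> [p p0 pP] [q q0 qQ]; exists (p * q); first exact: mulf_neq0.
move=> z l Dzl; rewrite rmorphM mulf_eq0 negb_or => /andP[pz qz].
by split; [exact: pP|exact: qQ].
Qed.

Lemma generically_forall (I : finType) D (P : I -> C -> 'rV[C]_d -> Prop) :
  (forall i, generically D (P i)) ->
  generically D (fun z l => forall i, P i z l).
Proof.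
move=> DP; have {}DP i : {q : {poly A} | q != 0 &
    forall z l, D (z, l) -> poly_eval z l q != 0 -> P i z l}.
  by exact: cid2 (DP i).
exists (\prod_i s2val (DP i)).
  by apply/prodf_neq0 => i _; exact: s2valP (DP i).
move=> z l Dzl; rewrite rmorph_prod => /prodf_neq0 qz i.
by apply: (s2valP' (DP i)) => //; exact: qz.
Qed.

Lemma generically_neq0 D f : f != 0 ->
  generically D (fun z l => rat_defined z l f /\ rat_eval z l f != 0).
Proof.
have [n [m [m0 ->]]] := frac_repr f => f0.
have n0 : n != 0 by apply: contraNneq f0 => ->; rewrite tofrac0 mul0r.
exists (n * m); first exact: mulf_neq0.
move=> z l _; rewrite rmorphM mulf_eq0 negb_or => /andP[nz mz].
have v : frac_value (eval_at z l) (tofrac n / tofrac m)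
  (poly_eval z l n / poly_eval z l m) by exists n, m.
split; first exact: frac_value_defined v.
by rewrite /rat_eval (frac_value_ext v) mulf_neq0 ?invr_eq0.
Qed.

Lemma generically_defined D f : generically D (fun z l => rat_defined z l f).
Proof.
have [n [m [m0 ->]]] := frac_repr f.
by exists m => // z l _ mz; exists n, m.
Qed.

Lemma generically_defined_mx D m n (F : 'M[ratfun C d]_(m, n)) :
  generically D (fun z l => forall i j, rat_defined z l (F i j)).
Proof.
apply: generically_forall => i; apply: generically_forall => j.
exact: generically_defined.
Qed.

Lemma generically_shift D P v :
  (forall z l, D (z, l) -> D (z, param_shift l v)) ->
  generically D P -> generically D (fun z l => P z (param_shift l v)).
Proof.
move=> Dv [q q0 qP]; exists (poly_shift v q).
  by rewrite (raddf_eq0 _ (@poly_shift_inj _ _ v)).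
by move=> z l /Dv Dzl; rewrite poly_eval_shift; exact: qP.
Qed.

(** The exceptional set on the base is the zero set of some [q]; upstairs it is
    the zero set of [q] composed with [phi], a nonzero rational function because
    [phi] is nonconstant. *)
Lemma generically_pullback D P phi : (forall c, phi <> tofrac c%:P) ->
  generically D P ->
  generically (pullback phi D) (fun x l => P (rat1_eval x phi) l).
Proof.
move=> nc [q q0 qP].
have cq0 : comp_frac d phi q != 0 by rewrite (raddf_eq0 _ (comp_frac_inj nc)).
apply: generically_imp (generically_neq0 _ cq0) => x l [/= phix Dx] [_].
rewrite /rat_eval (frac_value_ext (comp_frac_eval l q phix)); exact: qP.
Qed.

End Generic.

(** * The twisted matrix field *)

Lemma ratio_telescope (K : fieldType) (a b c : K) :
  b != 0 -> c / a = (b / a) * (c / b).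
Proof. by move=> b0; rewrite [RHS]mulrC mulrA divfK. Qed.

(** A scalar coboundary commutes with the matrices, and a substitution [g]
    commutes with the shift [s]. *)
Lemma cocycle_twist (K : fieldType) r (g s : {rmorphism K -> K})
    (Mvw Mv Mw : 'M[K]_r) (a b c : K) :
  (forall x, g (s x) = s (g x)) -> Mvw = Mv *m map_mx s Mw -> c = a * s b ->
  c *: map_mx g Mvw = (a *: map_mx g Mv) *m map_mx s (b *: map_mx g Mw).
Proof.
move=> gs -> ->; rewrite map_mxM map_mxZ -scalemxAl -scalemxAr scalerA.
by congr (_ *: (_ *m _)); apply/matrixP => i j; rewrite !mxE gs.
Qed.

(** The logarithmic derivatives of the two factors of the twist add up; [db] is
    the derivative of [b] with respect to [z], so [z * db] is its Euler
    derivative. *)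
Lemma log_derivative_twist (K : fieldType) (x z rho drho dphi b db : K) :
  rho != 0 -> z != 0 ->
  x * (rho * (db * dphi) + b * drho) =
  x * drho / rho * (rho * b) + x * dphi / z * (rho * (z * db)).
Proof. by move=> rho0 z0; field; rewrite rho0 z0. Qed.

Section Twist.
Variables (C : numClosedFieldType) (d r : nat).
Variables (D : set (C * 'rV[C]_d)) (B : C -> 'rV[C]_d -> 'rV[C]_r).
Variables (M : 'rV[int]_d -> 'M[ratfun C d]_r) (Mtheta : 'M[ratfun C d]_r).
Variables (phi : ratfun1 C) (rho : ratfun C d).
Hypothesis phi_nonconstant : forall c, phi <> tofrac c%:P.
Hypothesis rho_neq0 : rho != 0.

Local Notation Dt := (pullback phi D).
Local Notation Bt := (twist (fun t l => rat_eval t l rho) phi B).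
Local Notation Mt v :=
  ((rat_shift v rho / rho) *: map_mx (rat_comp phi) (M v)).
Local Notation Mthetat :=
  ((rat_var C d * rat_deriv rho / rho) *: 1%:M +
  (rat_var C d * rat_deriv (rat_const d phi) / rat_const d phi) *:
    map_mx (rat_comp phi) Mtheta).

(** The domain stays nonempty because a nonempty open slice contains
    infinitely many points [z0 + e / (k + 2)], and all but finitely many
    constants are values of [phi]. *)
Lemma pullback_param_domain : param_domain D -> param_domain Dt.
Proof.
move=> [[[z0 l0] D0] Dopen Dshift]; split.
- have [N [M' [cop _ phiE]]] := frac_coprime_repr phi.
  have nc c : tofrac N / tofrac M' <> tofrac c%:P by rewrite -phiE.
  have /(_ z0 D0) : forall z, D (z, l0) -> nbhs z [set w | D (w, l0)].
    by move=> z Dz; apply: open_nbhs_nbhs; split => //; exact: Dopen.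
  move=> /nbhs_ballP[e /= e0 De].
  pose f k := z0 + e / k.+2%:R.
  have f_inj : injective f.
    move=> i j /addrI/(mulfI (lt0r_neq0 e0))/invr_inj/eqP.
    by rewrite eqr_nat => /eqP[].
  have [k sk] := poly_nonroot f_inj (fibre_lead_neq0 nc).
  have [x xz] := fibre_nonempty nc sk.
  have [phix phixE] := fibre_rat1 cop nc xz.
  exists (x, l0); rewrite /pullback phiE /= phixE; split=> //.
  apply: De; rewrite /ball /= /f opprD addNKr normrN gtr0_norm ?divr_gt0//.
  by rewrite ltr_pdivrMr// ltr_pMr// ltr1n.
- move=> l; rewrite openE => x [/= phix Dx]; rewrite /interior.
  have : nbhs (rat1_eval x phi) [set z | D (z, l)].
    by apply: open_nbhs_nbhs; split=> //; exact: Dopen.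
  move=> /(rat1_eval_continuous phix) DN.
  have {}DN : \forall w \near x, D (rat1_eval w phi, l) by exact: DN.
  have phiN := near_rat1_defined phix.
  by near=> w; split; near: w.
- by move=> x l v [/= phix Dx]; split=> //=; exact: Dshift.
Unshelve. all: by end_near. Qed.

Lemma twist_is_cmf : is_cmf M -> is_cmf (fun v => Mt v).
Proof.
have [g gE] := rat_comp_rmorphism d phi_nonconstant.
have -> : (fun v => Mt v) =
    (fun v => (rat_shift v rho / rho) *: map_mx g (M v)).
  apply/funext => v; congr (_ *: _).
  by apply/matrixP => i j; rewrite !mxE gE.
have u0 v : rat_shift v rho / rho != 0.
  by rewrite mulf_eq0 invr_eq0 fmorph_eq0 orbb.
have uD v w : rat_shift (v + w) rho / rho =
    (rat_shift v rho / rho) * rat_shift v (rat_shift w rho / rho).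
  rewrite -rat_shiftD fmorph_div; apply: ratio_telescope.
  by rewrite fmorph_eq0.
move=> [Munit Mcocycle]; split=> [v|v w].
  rewrite unitmxZ; first by rewrite map_unitmx; exact: Munit.
  by rewrite unitfE; exact: u0.
apply: (@cocycle_twist _ _ g (rat_shift v)); [|exact: Mcocycle|exact: uD].
by move=> f; rewrite !gE; exact: rat_comp_shift.
Qed.

Lemma twist_shift v :
  (forall z l, D (z, l) -> D (z, param_shift l v)) ->
  generically D (fun z l =>
    B z (param_shift l v) = B z l *m map_mx (rat_eval z l) (M v)) ->
  generically Dt (fun x l =>
    Bt x (param_shift l v) = Bt x l *m map_mx (rat_eval x l) (Mt v)).
Proof.
move=> Dv BM.
have Dtv x l : Dt (x, l) -> Dt (x, param_shift l v) by move=> [phix /Dv].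
have := generically_and (generically_pullback phi_nonconstant
  (generically_and BM (generically_defined_mx _ (M v))))
  (generically_and (generically_neq0 Dt rho_neq0)
    (generically_shift Dtv (generically_defined Dt rho))).
apply: generically_imp => x l [/= phix Dx] [[BE Mdef] [[rhodef rho0] rhodef']].
have -> : map_mx (rat_eval x l) (Mt v) =
    (rat_eval x (param_shift l v) rho / rat_eval x l rho) *:
    map_mx (rat_eval (rat1_eval x phi) l) (M v).
  apply/matrixP => i j; rewrite !mxE.
  apply: (@frac_value_ext _ _ (eval_at x l)).
  apply: frac_valueM.
    2: exact: rat_comp_value phix (frac_defined_value (Mdef i j)).
  apply: frac_value_div rho0; last exact: frac_defined_value.
  exact: rat_shift_value (frac_defined_value rhodef').
by rewrite /twist BE -scalemxAl -scalemxAr scalerA mulrC divfK.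
Qed.

Lemma twist_derivative :
  generically D (fun z l => forall j : 'I_r,
    derivable (fun w : C => B w l 0 j) z 1 /\
    z * derive1 (fun w : C => B w l 0 j) z =
      (B z l *m map_mx (rat_eval z l) Mtheta) 0 j) ->
  generically Dt (fun x l => forall j : 'I_r,
    derivable (fun w : C => Bt w l 0 j) x 1 /\
    x * derive1 (fun w : C => Bt w l 0 j) x =
      (Bt x l *m map_mx (rat_eval x l) Mthetat) 0 j).
Proof.
move=> BM; have phi0 : rat_const d phi != 0.
  rewrite fmorph_eq0; apply/eqP => phi0; apply: (phi_nonconstant (c := 0)).
  by rewrite phi0 tofrac0.
have := generically_and (generically_pullback phi_nonconstant
  (generically_and BM (generically_defined_mx _ Mtheta)))
  (generically_and (generically_neq0 Dt rho_neq0) (generically_neq0 Dt phi0)).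
apply: generically_imp => x l [/= phix Dx].
move=> [[BE Mdef] [[rhodef rho0] [phidef]]].
rewrite [rat_eval x l (rat_const d phi)]
  (frac_value_ext (rat_const_value l phix)) => phix0 j.
have [dB BtE] := BE j.
set z := rat1_eval x phi in phix0 dB BtE Mdef *.
set dphi := rat_eval x l (rat_deriv (rat_const d phi)).
set drho := rat_eval x l (rat_deriv rho).
have [ddef drhoE] := rat_eval_is_derive rhodef.
have [dphidef _] := rat_eval_is_derive phidef.
have varE : frac_value (eval_at x l) (rat_var C d) x.
  exact: rat_var_value.
have -> : map_mx (rat_eval x l) Mthetat =
    (x * drho / rat_eval x l rho)%:M +
    (x * dphi / z) *: map_mx (rat_eval z l) Mtheta.
  apply/matrixP => i k; rewrite !mxE -[in RHS]mulr_natr.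
  apply: (@frac_value_ext _ _ (eval_at x l)); apply: frac_valueD.
    apply: frac_valueM; last first.
      apply: (@frac_value_tofrac_eq _ _ _ _ ((i == k)%:R)).
        by rewrite rmorph_nat.
      by rewrite rmorph_nat.
    apply: frac_value_div rho0; last exact: frac_defined_value.
    by apply: frac_valueM => //; exact: frac_defined_value.
  apply: frac_valueM.
    2: exact: rat_comp_value phix (frac_defined_value (Mdef i k)).
  apply: frac_value_div phix0; last exact: rat_const_value.
  by apply: frac_valueM => //; exact: frac_defined_value.
rewrite mulmxDr mul_mx_scalar -scalemxAr -scalemxAl !mxE.
rewrite mxE in BtE; rewrite -BtE.
have -> : (fun w : C => Bt w l 0 j) =
    (fun w => rat_eval w l rho * B (rat1_eval w phi) l 0 j).
  by apply/funext => w; rewrite mxE.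
have [dBt ->] := derive1_twist drhoE (rat1_eval_is_derive l phix) dB.
split; first exact: dBt.
exact: log_derivative_twist.
Qed.

End Twist.

(** * Linear independence after composition *)

Section Elimination.
Variables (C : numClosedFieldType) (d : nat) (N M : {poly C}).
Local Notation A := (mpoly d C).
Local Notation phi := (tofrac N / tofrac M).
Local Notation deg := (maxn (size N) (size M)).-1.
Hypothesis NM_coprime : coprimep N M.
Hypothesis phi_nonconstant : forall c, phi <> tofrac c%:P.

Definition scalar_const : {rmorphism C -> {poly A}} := polyC \o @mpolyC d C.

(** The polynomial [N(X) - z M(X)] in [X] with generic [z]: the variable of the
    coefficients is [z], the outer one is [X]. *)
Definition fibre_poly : {poly {poly A}} :=
  map_poly scalar_const N - 'X *: map_poly scalar_const M.

Lemma map_fibre_poly (S : comNzRingType) (h : {rmorphism {poly A} -> S})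
    (g : C -> S) (t : S) :
  h \o scalar_const =1 g -> h 'X = t ->
  map_poly h fibre_poly = map_poly g N - t *: map_poly g M.
Proof.
by move=> hg <-; rewrite rmorphB /= map_polyZ -!map_poly_comp !(eq_map_poly hg).
Qed.

Lemma fibre_poly_coef_deg :
  fibre_poly`_deg = map_poly (@mpolyC d C) (fibre_lead N M).
Proof.
have -> : map_poly (@mpolyC d C) (fibre_lead N M) =
    scalar_const N`_deg - scalar_const M`_deg * 'X.
  by rewrite raddfB /= map_polyC map_polyZ map_polyX mul_polyC.
rewrite coefB coefZ; congr (_ - _); first exact: coef_map.
by rewrite mulrC; congr (_ * _); exact: coef_map.
Qed.

Lemma map_fibre_lead_neq0 : map_poly (@mpolyC d C) (fibre_lead N M) != 0.
Proof.
rewrite map_poly_eq0_id0 ?fibre_lead_neq0//.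
by rewrite mpolyC_eq0 lead_coef_eq0 fibre_lead_neq0.
Qed.

Lemma size_fibre_poly : size fibre_poly = deg.+1.
Proof.
apply/eqP; rewrite eqn_leq; apply/andP; split.
  rewrite prednK; last first.
    by rewrite (leq_trans (fibre_deg_gt0 phi_nonconstant))// leq_pred.
  apply: leq_trans (size_polyD _ _) _; rewrite size_polyN geq_max.
  apply/andP; split.
    by apply: leq_trans (size_poly _ _) _; exact: leq_maxl.
  apply: leq_trans (size_scale_leq _ _) _.
  by apply: leq_trans (size_poly _ _) _; exact: leq_maxr.
rewrite ltnNge; apply/negP => /leq_sizeP/(_ _ (leqnn _))/eqP.
by rewrite fibre_poly_coef_deg (negPf map_fibre_lead_neq0).
Qed.

Lemma lead_coef_fibre_poly :
  lead_coef fibre_poly = map_poly (@mpolyC d C) (fibre_lead N M).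
Proof. by rewrite lead_coefE size_fibre_poly fibre_poly_coef_deg. Qed.

Lemma eval_fibre_poly z (l : 'rV[C]_d) :
  map_poly (eval_at z l) fibre_poly = fibre N M z.
Proof.
rewrite (map_fibre_poly (g := idfun) (t := z)) ?map_poly_id//;
  last exact: poly_evalX.
by move=> c; rewrite /= poly_evalC mevalC.
Qed.

Lemma horner_fibre_poly z :
  map_poly (horner_eval (mpolyC d z)) fibre_poly =
  map_poly (@mpolyC d C) (fibre N M z).
Proof.
transitivity (map_poly (@mpolyC d C) N -
  mpolyC d z *: map_poly (@mpolyC d C) M).
  2: by rewrite /fibre raddfB /= map_polyZ.
apply: map_fibre_poly.
  by move=> c; rewrite /= /horner_eval hornerC.
by rewrite /= /horner_eval hornerX.
Qed.

Lemma eval_map_polyC x z (l : 'rV[C]_d) (q : {poly A}) :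
  (map_poly (eval_at z l) (map_poly polyC q)).[x] = poly_eval x l q.
Proof.
rewrite -map_poly_comp /poly_eval; congr (_.[x]).
by apply: eq_map_poly => a; rewrite /= poly_evalC.
Qed.

Lemma common_root_fibre z (q : {poly A}) :
  (fibre_lead N M).[z] != 0 ->
  (size (gcdp (map_poly (@mpolyC d C) (fibre N M z)) q) > 1)%N ->
  exists x, root (fibre N M z) x /\ root q (mpolyC d x).
Proof.
move=> sz; apply: contraPP => noroot.
have [rs fE] := closed_field_poly_normal (fibre N M z).
have F0 : fibre N M z != 0.
  by rewrite -size_poly_eq0 (size_fibre phi_nonconstant sz).
suff : coprimep q (map_poly (@mpolyC d C) (fibre N M z)).
  by rewrite coprimep_sym /coprimep => /eqP ->.
rewrite fE map_polyZ /= coprimepZr ?mpolyC_eq0 ?lead_coef_eq0//.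
rewrite rmorph_prod /=.
have : forall x, x \in rs -> ~~ root q (mpolyC d x).
  move=> x xrs; apply/negP => qx; apply: noroot; exists x; split=> //.
  by rewrite fE rootZ ?lead_coef_eq0// root_prod_XsubC.
elim: rs {fE} => [|x rs IH] rsP; first by rewrite big_nil coprimep1.
rewrite big_cons coprimepMr; apply/andP; split.
  by rewrite rmorphB /= map_polyX map_polyC coprimep_XsubC rsP ?mem_head.
by apply: IH => y yrs; apply: rsP; rewrite inE yrs orbT.
Qed.

Lemma nonroots (p : {poly C}) n : p != 0 ->
  exists zs : seq C,
    [/\ uniq zs, size zs = n & forall z, z \in zs -> p.[z] != 0].
Proof.
move=> p0; elim: n => [|n [zs [uzs szs pzs]]]; first by exists [::].
have inj : injective (fun k => k%:R : C).
  by move=> i j /eqP; rewrite eqr_nat => /eqP.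
have z0 : \prod_(z <- zs) ('X - z%:P) != 0.
  by rewrite monic_neq0 ?monic_prod_XsubC.
have [k] := poly_nonroot inj (mulf_neq0 p0 z0).
rewrite hornerM mulf_eq0 negb_or => /andP[pk].
rewrite -[_ == 0]/(root _ _) root_prod_XsubC => kzs.
exists (k%:R :: zs); split=> [|/=|z]; first by rewrite /= kzs.
  by rewrite szs.
by rewrite inE => /predU1P[->//|/pzs].
Qed.

(** A property that holds for generic [x] holds for all the preimages of a
    generic [z]. The exceptional polynomial in [z] is the resultant in [X] of
    [fibre_poly] and [q(X)]: it lies in the ideal that they span, so it vanishes
    at [z] if they have a common zero over [z]. If it were zero, then so would
    be its specialization at any constant [z]; each of infinitely many [z]
    would then have a preimage among the constant roots of [q], and distinct
    points have distinct preimages. *)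
Lemma fibre_avoid (q : {poly A}) : q != 0 ->
  exists2 Q : {poly A}, Q != 0 & forall z (l : 'rV[C]_d) x,
    poly_eval z l Q != 0 -> root (fibre N M z) x -> poly_eval x l q != 0.
Proof.
move=> q0; have [q1|q1] := leqP (size q) 1.
  have [a a0 qE] : exists2 a, a != 0 & q = a%:P.
    exists q`_0; last exact: size1_polyC.
    by apply: contra q0 => /eqP E; rewrite (size1_polyC q1) E.
  by exists a%:P; rewrite ?polyC_eq0// qE => z l x; rewrite !poly_evalC.
have lead_q : lead_coef (map_poly polyC q : {poly {poly A}}) = (lead_coef q)%:P.
  by rewrite lead_coef_map_inj//; exact: polyC_inj.
have size_q : size (map_poly polyC q : {poly {poly A}}) = size q.
  by rewrite size_map_inj_poly//; exact: polyC_inj.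
(* [q] is read as a polynomial in the outer variable. *)
exists (resultant fibre_poly (map_poly polyC q)); last first.
  move=> z l x Q0 fx; apply: contraNneq Q0 => qx.
  have sP : (size fibre_poly > 1)%N.
    by rewrite size_fibre_poly ltnS (fibre_deg_gt0 phi_nonconstant).
  have sq : (size (map_poly polyC q : {poly {poly A}}) > 1)%N by rewrite size_q.
  have [[u v] _ /= E] := resultant_in_ideal sP sq.
  pose ev g := (map_poly (eval_at z l) g).[x].
  have : ev (resultant fibre_poly (map_poly polyC q))%:P =
      ev u * ev fibre_poly + ev v * ev (map_poly polyC q).
    by rewrite E /ev rmorphD !rmorphM hornerD !hornerM.
  rewrite /ev eval_fibre_poly eval_map_polyC qx (eqP fx) !mulr0 addr0.
  by rewrite map_polyC hornerC => ->.
apply/eqP => res0.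
have [zs [uzs szs zsP]] := nonroots (size q) (fibre_lead_neq0 phi_nonconstant).
have common z : exists x,
    z \in zs -> root (fibre N M z) x /\ root q (mpolyC d x).
  have [zin|_] := boolP (z \in zs); last by exists 0.
  have [x xP] : exists x, root (fibre N M z) x /\ root q (mpolyC d x).
    apply: common_root_fibre; first exact: zsP.
    rewrite -resultant_eq0 -horner_fibre_poly.
    have <- : map_poly (horner_eval (mpolyC d z)) (map_poly polyC q) = q.
      rewrite -map_poly_comp map_poly_id// => a _.
      by rewrite /= /horner_eval hornerC.
    rewrite -map_resultant; first by rewrite res0 /= /horner_eval horner0.
      rewrite lead_coef_fibre_poly /= /horner_eval horner_map mpolyC_eq0.
      exact: zsP.
    by rewrite lead_q /= /horner_eval hornerC lead_coef_eq0.
  by exists x.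
have [f fP] := choice common.
have := @max_poly_roots _ q (map (fun z => mpolyC d (f z)) zs) q0.
rewrite size_map szs ltnn => H; suff : false by []; apply: H.
  by apply/allP => _ /mapP[z zin ->]; have [] := fP z zin.
rewrite map_inj_in_uniq// => z z' zin z'in /(can_inj (@mpolyCK _ _)) fE.
have [/(fibre_root NM_coprime)[Mx Nx] _] := fP z zin.
have [/(fibre_root NM_coprime)[_ ]] := fP z' z'in.
by rewrite -fE Nx => /(mulIf Mx).
Qed.

(** The generic point of the graph of [phi]: substituting [phi] for [z] and the
    variable for [X] recovers a polynomial in [X] and kills [fibre_poly]. *)
Lemma comp_map_polyC (p : {poly A}) :
  (map_poly (comp_frac d phi) (map_poly polyC p)).[tofrac 'X] = tofrac p.
Proof.
rewrite -map_poly_comp (eq_map_poly (g := @tofrac {poly A} \o polyC));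
  last first.
  by move=> a; rewrite -[LHS]/(comp_frac d phi a%:P) comp_fracC.
rewrite map_poly_comp horner_map; congr tofrac.
by rewrite -[RHS]comp_polyXr.
Qed.

Lemma comp_fibre_poly :
  (map_poly (comp_frac d phi) fibre_poly).[tofrac 'X] = 0.
Proof.
have cE (p : {poly C}) :
    (map_poly (@tofrac {poly A} \o scalar_const) p).[tofrac 'X] =
    poly_const C d p.
  rewrite map_poly_comp horner_map [map_poly scalar_const p]map_poly_comp.
  by congr tofrac; rewrite -[RHS]comp_polyXr.
rewrite (map_fibre_poly (g := @tofrac {poly A} \o scalar_const)
  (t := rat_const d phi)); first last.
- exact: comp_fracX.
- by move=> a; rewrite -[LHS]/(comp_frac d phi (mpolyC d a)%:P) comp_fracC.
rewrite hornerD hornerN hornerZ !cE.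
have M0 : poly_const C d M != 0.
  rewrite (raddf_eq0 _ (@poly_const_inj C d)); apply/eqP => M0.
  by apply: (phi_nonconstant (c := 0)); rewrite M0 !tofrac0 invr0 mulr0.
have -> : rat_const d phi = poly_const C d N / poly_const C d M.
  by apply: (@frac_value_ext _ _ (poly_const C d)); exists N, M.
by rewrite divfK// subrr.
Qed.

(** It vanishes at the double points of fibres. *)
Definition wronskian : {poly C} := N^`() * M - N * M^`().

(** A vanishing Wronskian makes [M] divide its own derivative, by coprimality,
    so [M] and then [N] are constant in characteristic zero. *)
Lemma wronskian_neq0 : wronskian != 0.
Proof.
rewrite /wronskian subr_eq0; apply/negP => /eqP W0.
have M0 : M != 0.
  apply/eqP => M0; apply: (phi_nonconstant (c := 0)).
  by rewrite M0 !tofrac0 invr0 mulr0.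
have deriv0 (p : {poly C}) : p^`() = 0 -> (size p <= 1)%N.
  move=> /polyP p'0; apply/leq_sizeP => -[//|i] _.
  by have /eqP := p'0 i; rewrite coef_deriv coef0 mulrn_eq0 => /eqP.
have dM0 : M^`() = 0.
  apply/eqP/negPn/negP => dM0.
  have : M %| M^`().
    by rewrite -(Gauss_dvdpr _ (q := N)) 1?coprimep_sym// -W0 dvdp_mull.
  by move/(dvdp_leq dM0); rewrite leqNgt lt_size_deriv.
have dN0 : N^`() = 0.
  by apply/eqP; move/eqP: W0; rewrite dM0 mulr0 mulf_eq0 (negPf M0) orbF.
have := fibre_deg_gt0 phi_nonconstant.
by rewrite ltnNge -subn1 leq_subLR addn0 geq_max !deriv0.
Qed.

Lemma uniq_fibre z : (fibre_lead N M).[z] != 0 ->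
  (forall x, root (fibre N M z) x -> wronskian.[x] != 0) ->
  exists rs : seq C, [/\ uniq rs, size rs = deg &
    forall x, x \in rs -> root (fibre N M z) x].
Proof.
move=> sz simple; have sF := size_fibre phi_nonconstant sz.
have [rs fE] := closed_field_poly_normal (fibre N M z).
have lc0 : lead_coef (fibre N M z) != 0.
  by rewrite lead_coef_eq0 -size_poly_eq0 sF.
exists rs; split.
- rewrite -separable_prod_XsubC.
  have : separable_poly (fibre N M z).
    rewrite unlock; apply: Pdiv.ClosedField.root_coprimep => x fx.
    have [_ Nx] := fibre_root NM_coprime fx.
    apply: contraNneq (simple x fx).
    rewrite derivB derivZ hornerD hornerN hornerZ => /subr0_eq dNx.
    by rewrite hornerD hornerN !hornerM dNx Nx mulrAC subrr.
  by rewrite {1}fE (eqp_separable (eqp_scale _ lc0)).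
- by move: sF; rewrite fE size_scale// size_prod_XsubC => -[].
- by move=> x xrs; rewrite fE rootZ// root_prod_XsubC.
Qed.

End Elimination.

Lemma common_denominator (A : idomainType) (I : finType)
    (F : I -> {fraction A}) :
  exists2 m : A, m != 0 &
    exists p : I -> A, forall i, tofrac (p i) = F i * tofrac m.
Proof.
have /choice[nm nmP] i : exists nm : A * A,
    nm.2 != 0 /\ F i = tofrac nm.1 / tofrac nm.2.
  by have [n [m [m0 FE]]] := frac_repr (F i); exists (n, m).
exists (\prod_i (nm i).2); first by apply/prodf_neq0 => i _; have [] := nmP i.
exists (fun i => (nm i).1 * \prod_(j | j != i) (nm j).2) => i.
have [m0 ->] := nmP i.
by rewrite [in RHS](bigD1 i)//= !tofracM mulrA divfK// tofrac_eq0.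
Qed.

Section RowBasis.
Variables (C : numClosedFieldType) (d r : nat).
Local Notation A := (mpoly d C).
Variables (D : set (C * 'rV[C]_d)) (B : C -> 'rV[C]_d -> 'rV[C]_r).
Variables (phi : ratfun1 C) (rho : ratfun C d).
Hypothesis phi_nonconstant : forall c, phi <> tofrac c%:P.
Hypothesis rho_neq0 : rho != 0.
Local Notation Dt := (pullback phi D).
Local Notation Bt := (twist (fun t l => rat_eval t l rho) phi B).

(** Clearing denominators, and dividing by the values of [rho], turns a relation
    between the entries of the twist into one with polynomial coefficients
    between the entries of [B] at [phi(x)]. *)
Lemma twist_relation (c : 'cV[ratfun C d]_r) :
  generically Dt (fun x l => Bt x l *m map_mx (rat_eval x l) c = 0) ->
  exists2 m : {poly A}, m != 0 & exists2 p : 'I_r -> {poly A},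
    forall i, tofrac (p i) = c i 0 * tofrac m &
    generically Dt (fun x l =>
      \sum_i B (rat1_eval x phi) l 0 i * poly_eval x l (p i) = 0).
Proof.
move=> cB; have [m m0 [p pE]] := common_denominator (fun i => c i 0).
exists m => //; exists p => //.
have := generically_and cB (generically_and (generically_neq0 Dt rho_neq0)
  (generically_defined_mx Dt c)).
apply: generically_imp => x l _ [cx [[_ rho0] cdef]].
have pxE i : poly_eval x l (p i) = rat_eval x l (c i 0) * poly_eval x l m.
  apply: (@frac_value_unique _ _ (eval_at x l) (tofrac (p i))).
    exact: (frac_value_tofrac (eval_at x l)).
  rewrite pE; apply: frac_valueM; first exact: frac_defined_value (cdef i 0).
  exact: (frac_value_tofrac (eval_at x l)).
have /matrixP/(_ 0 0) := cx.
rewrite /twist -scalemxAl !mxE => /eqP; rewrite mulf_eq0 (negPf rho0) => /eqP E.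
transitivity ((\sum_i B (rat1_eval x phi) l 0 i * map_mx (rat_eval x l) c i 0)
    * poly_eval x l m); last by rewrite E mul0r.
by rewrite mulr_suml; apply: eq_bigr => i _; rewrite pxE mxE mulrA.
Qed.

(** The coefficients upstairs lie in [C(x, lambda)], an extension of
    [C(phi(x), lambda)], so a relation has to be pushed down. Dividing its
    polynomial coefficients [p i] by [N(X) - z M(X)] writes them, up to a power
    of the leading coefficient [s], as [\sum_j e_ij(phi(x), lambda) x^j] with
    [j] below the degree [n] of [phi]. A generic [z] has [n] distinct preimages,
    all in the pulled-back domain, where the same [B(z, lambda)] occurs. The
    polynomial in [x] with coefficients [\sum_i e_ij B_i] thus has more roots
    than its degree allows. So every [\sum_i e_ij B_i] vanishes, and the
    independence of the [B_i] forces [e_ij = 0]. *)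
Lemma row_basis_twist : row_basis D B -> row_basis Dt Bt.
Proof.
move=> Bfree c /twist_relation[m m0 [p pE [q q0 qP]]].
pose deg (N M : {poly C}) := (maxn (size N) (size M)).-1.
have [N [M [cop _ phiE]]] := frac_coprime_repr phi.
have nc k : tofrac N / tofrac M <> tofrac k%:P by rewrite -phiE.
pose P := fibre_poly d N M; pose s := map_poly (@mpolyC d C) (fibre_lead N M).
pose W := map_poly (@mpolyC d C) (wronskian N M).
have W0 : W != 0.
  rewrite map_poly_eq0_id0 ?(wronskian_neq0 cop nc)//.
  by rewrite mpolyC_eq0 lead_coef_eq0 (wronskian_neq0 cop nc).
have s0 : s != 0 := map_fibre_lead_neq0 d nc.
have [Q Q0 QP] := fibre_avoid cop nc (mulf_neq0 q0 W0).
pose ph i : {poly {poly A}} := map_poly polyC (p i).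
pose k i := scalp (ph i) P.
have divE i : s ^+ k i *: ph i = (ph i %/ P) * P + (ph i %% P).
  by rewrite /s -(lead_coef_fibre_poly d nc) -Pdiv.Idomain.divp_eq.
have P0 : P != 0 by rewrite -size_poly_eq0 (size_fibre_poly d nc).
have size_rem i : (size (ph i %% P)%R <= deg N M)%N.
  by rewrite -ltnS -(size_fibre_poly d nc) ltn_modp.
(* If the remainders vanish, then so does [p i] at the generic point of the
   graph of [phi], where [P] is zero and [s] is not. *)
suff rem0 : forall i, ph i %% P = 0.
  apply/matrixP => i j; rewrite ord1 mxE.
  have cs0 : comp_frac d phi (s ^+ k i) != 0.
    by rewrite (raddf_eq0 _ (comp_frac_inj phi_nonconstant)) expf_neq0.
  have E : comp_frac d phi (s ^+ k i) * tofrac (p i) = 0.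
    have := congr1
      (fun g => (map_poly (comp_frac d phi) g).[tofrac 'X]) (divE i).
    rewrite rem0 addr0 map_polyZ hornerZ phiE comp_map_polyC => ->.
    by rewrite rmorphM hornerM [X in _ * X]comp_fibre_poly// mulr0.
  move/eqP: E; rewrite mulf_eq0 (negPf cs0) pE mulf_eq0 tofrac_eq0.
  rewrite (negPf m0) orbF.
  by move/eqP.
(* The coefficients of the remainders form relations downstairs. *)
have rem_coef j :
    \col_i (tofrac (ph i %% P)`_j / tofrac (s ^+ k i)) = 0
    :> 'cV[ratfun C d]_r.
  apply: Bfree; exists (Q * s); first exact: mulf_neq0.
  move=> z l Dzl; rewrite poly_evalM mulf_eq0 negb_or => /andP[Qz].
  rewrite [poly_eval z l s]poly_eval_map_mpolyC => sz.
  have avoid x : root (fibre N M z) x ->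
      poly_eval x l q != 0 /\ (wronskian N M).[x] != 0.
    move/(QP z l x Qz); rewrite poly_evalM mulf_eq0 negb_or.
    rewrite [poly_eval x l W]poly_eval_map_mpolyC.
    by move/andP.
  have [rs [urs srs rsP]] := uniq_fibre cop nc sz (fun x fx => (avoid x fx).2).
  pose b i := B z l 0 i / (fibre_lead N M).[z] ^+ k i.
  (* For fixed [z] and [l], the relation as a polynomial in [x]; it vanishes at
     all the preimages of [z]. *)
  pose U := \sum_i b i *: map_poly (eval_at z l) (ph i %% P).
  have sk i : poly_eval z l (s ^+ k i) = (fibre_lead N M).[z] ^+ k i.
    by rewrite rmorphXn /= poly_eval_map_mpolyC.
  have U0 : U = 0.
    apply/eqP/negPn/negP => U0; have := @max_poly_roots _ U rs U0.
    rewrite urs srs => H; suff : (deg N M < deg N M)%N by rewrite ltnn.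
    apply: (leq_trans (H _ isT)); last first.
      apply: leq_trans (size_sum _ _ _) _; apply/bigmax_leqP => i _.
      apply: leq_trans (size_scale_leq _ _) _.
      exact: leq_trans (size_poly _ _) (size_rem i).
    apply/allP => x /rsP fx; rewrite /root horner_sum.
    have [phix phixE] := fibre_rat1 cop nc fx.
    have Dx : Dt (x, l) by rewrite /pullback phiE /= phixE.
    have := qP x l Dx (avoid x fx).1; rewrite phiE phixE => E0.
    rewrite -[X in _ == X]E0; apply/eqP; apply: eq_bigr => i _.
    have := congr1 (fun g => (map_poly (eval_at z l) g).[x]) (divE i).
    rewrite map_polyZ hornerZ eval_map_polyC [eval_at z l _]sk => E.
    rewrite hornerZ.
    have eP : (map_poly (eval_at z l) P).[x] = 0.
      by rewrite eval_fibre_poly; exact/eqP.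
    have -> : (map_poly (eval_at z l) (ph i %% P)).[x] =
        (fibre_lead N M).[z] ^+ k i * poly_eval x l (p i).
      by rewrite E rmorphD rmorphM hornerD hornerM [X in _ * X]eP mulr0 add0r.
    by rewrite /b mulrA divfK ?expf_neq0.
  have /polyP/(_ j) := U0; rewrite coef0 coef_sum => Uj.
  apply/matrixP => i0 j0; rewrite !mxE -[RHS]Uj; apply: eq_bigr => i _.
  rewrite !mxE coefZ coef_map ord1 /b mulrAC -mulrA; congr (_ * _).
  apply: (@frac_value_ext _ _ (eval_at z l)).
  apply: frac_value_div; first exact: frac_value_tofrac.
    by rewrite -(sk i); exact: (frac_value_tofrac (eval_at z l)).
  exact: expf_neq0.
move=> i; apply/polyP => j; have /matrixP/(_ i 0) := rem_coef j.
rewrite !mxE coef0 => /eqP.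
rewrite mulf_eq0 invr_eq0 !tofrac_eq0 expf_eq0 (negPf s0) andbF orbF.
by move/eqP.
Qed.

End RowBasis.

(** * The twisted basis and its symmetric square *)

Lemma sym2_scale (C : numClosedFieldType) (a : C) (b : 'rV[C]_2) :
  sym2 (a *: b) = a ^+ 2 *: sym2 b.
Proof.
apply/rowP => -[[|[|[|//]]] lt3]; rewrite !mxE /= ?exprMn// mulrACA -expr2.
by [].
Qed.

Theorem theorem4p14 (R : realType) (d r : nat)
    (D : set (R[i] * 'rV[R[i]]_d))
    (B : R[i] -> 'rV[R[i]]_d -> 'rV[R[i]]_r)
    (M : 'rV[int]_d -> 'M[ratfun R[i] d]_r) (Mtheta : 'M[ratfun R[i] d]_r)
    (phi : ratfun1 R[i]) (rho : ratfun R[i] d)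
    (B_generates : generates D B M Mtheta)
    (phi_nonconstant : forall c : R[i], phi <> tofrac c%:P)
    (rho_neq0 : rho != 0) :
  let phi' := rat_deriv (rat_const d phi) in
  let x := rat_var R[i] d in
  let Dt := pullback phi D in
  let rho_fun := fun t l => rat_eval t l rho in
  let Bt := twist rho_fun phi B in
  let Mt := fun v =>
    (rat_shift v rho / rho) *: map_mx (rat_comp phi) (M v) in
  let Mthetat :=
    (x * rat_deriv rho / rho) *: 1%:M +
    (x * phi' / rat_const d phi) *: map_mx (rat_comp phi) Mtheta in
  [/\ generates Dt Bt Mt Mthetat,
      row_basis D B -> row_basis Dt Bt,
      (exists rho0 : ratfun1 R[i], rho = rat_const d rho0) ->
        forall v, Mt v = map_mx (rat_comp phi) (M v)
    & forall (r2 : r = 2%N) (S : set (R[i] * 'rV[R[i]]_d))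
        (sqrt_rho : R[i] -> 'rV[R[i]]_d -> R[i]),
        let Sym2 (b : 'rV[R[i]]_r) := sym2 (castmx (erefl 1%N, r2) b) in
        S `<=` Dt ->
        (forall t l, S (t, l) ->
          rat_defined t l rho /\ sqrt_rho t l ^+ 2 = rho_fun t l) ->
        forall t l, S (t, l) ->
          Sym2 (twist sqrt_rho phi B t l) =
          twist rho_fun phi (fun z l => Sym2 (B z l)) t l].
Proof.
move=> phi' x Dt rho_fun Bt Mt Mthetat.
have [Ddom Mcmf Bshift Btheta] := B_generates.
split.
- split.
  + exact: pullback_param_domain.
  + exact: twist_is_cmf.
  + move=> v; apply: (twist_shift phi_nonconstant rho_neq0 _ (Bshift v)).
    by move=> z l; have [_ _] := Ddom; exact.
  + exact: twist_derivative.
- exact: row_basis_twist.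
- move=> [rho0 rhoE] v.
  have u : rat_shift v rho / rho = 1.
    by rewrite rhoE rat_shift_const -rhoE divff.
  by rewrite /Mt u scale1r.
- move=> r2 S sqrt_rho Sym2 SD sqrtP t l Stl; have [_ sq] := sqrtP t l Stl.
  have castZ a (b : 'rV_r) :
      castmx (erefl 1%N, r2) (a *: b) = a *: castmx (erefl 1%N, r2) b.
    by apply/rowP => j; rewrite !(castmxE, mxE).
  by rewrite /twist -sq /Sym2 castZ sym2_scale.
Qed.
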